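(* Let $(M,F)$ be a surface of revolution endowed with its strongly convex slope metric $F=\frac{\alpha^2}{\alpha-\beta}$. Then the meridians of $M$, parametrized to have unit $F$-speed, are $F$-geodesics.
   Context: Let $I\subset\mathbb{R}$ be an open interval and $m:I\to(0,\infty)$ smooth. The surface of revolution $M\to\mathbb{R}^3$ is $(u,v)\mapsto(m(u)\cos v,\,m(u)\sin v,\,u)$, $u\in I$, $v\in\mathbb{S}^1$. Its slope metric is $F=\frac{\alpha^2}{\alpha-\beta}$ with $\alpha=\sqrt{[1+(m')^2]\dot u^2+m^2\dot v^2}$, $\beta=\dot u$, in the canonical coordinates $(u,v,\dot u,\dot v)$ of $TM$; it is strongly convex when $\alpha>\beta$ and $\frac12\frac{\partial^2F^2}{\partial y^i\partial y^j}$ (with $(y^1,y^2)=(\dot u,\dot v)$) is positive definite on all nonzero tangent vectors. A meridian is a curve $u=u(s)$, $v=v_0$ constant. A curve $\mathcal{P}$ has unit $F$-speed if $F(\mathcal{P},\dot{\mathcal{P}})=1$. *)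

(* Defs.v *)
From Stdlib Require Import Reals.
From Coquelicot Require Import Coquelicot.
Open Scope R_scope.

(** * Finsler geometry in a two-dimensional coordinate chart

    Points [x] and tangent vectors [y] are given by their coordinates in
    [R * R]; a Finsler function is a map [F x y].  [Derive] is total, so the
    expressions below are meaningful where [F] is smooth, that is for
    [y <> 0]. *)

Inductive index := i1 | i2.

Definition coord (i : index) (p : R * R) : R :=
  match i with i1 => fst p | i2 => snd p end.

Definition set_coord (i : index) (t : R) (p : R * R) : R * R :=
  match i with i1 => (t, snd p) | i2 => (fst p, t) end.

Definition sum_index (f : index -> R) : R := f i1 + f i2.

Definition partial (i : index) (f : R * R -> R) (p : R * R) : R :=
  Derive (fun t => f (set_coord i t p)) (coord i p).

Section Finsler.

Variable F : R * R -> R * R -> R.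

(** [g_ij = 1/2 [F^2]_{y^i y^j}] *)
Definition fundamental_tensor (i j : index) (x y : R * R) : R :=
  / 2 * partial i (fun y' => partial j (fun y'' => F x y'' ^ 2) y') y.

Definition positive_definite_at (x y : R * R) : Prop :=
  forall w : R * R, w <> (0, 0) ->
    0 < sum_index (fun i => sum_index (fun j =>
          fundamental_tensor i j x y * coord i w * coord j w)).

(** [g^ij], by Cramer's rule for the 2 x 2 matrix [g_ij] *)
Definition inverse_tensor (i j : index) (x y : R * R) : R :=
  let g k l := fundamental_tensor k l x y in
  let det := g i1 i1 * g i2 i2 - g i1 i2 * g i2 i1 in
  match i, j with
  | i1, i1 => g i2 i2 / det
  | i1, i2 => - g i1 i2 / det
  | i2, i1 => - g i2 i1 / det
  | i2, i2 => g i1 i1 / det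
  end.

(** [G^i = 1/4 g^il ([F^2]_{x^k y^l} y^k - [F^2]_{x^l})] *)
Definition spray (i : index) (x y : R * R) : R :=
  / 4 * sum_index (fun l =>
    inverse_tensor i l x y *
    (sum_index (fun k =>
       partial k (fun x' => partial l (fun y' => F x' y' ^ 2) y) x
       * coord k y)
     - partial l (fun x' => F x' y ^ 2) x)).

End Finsler.

(** * Curves *)

(** The endpoints may be infinite. *)
Definition in_interval (a b : Rbar) (t : R) : Prop :=
  Rbar_lt a t /\ Rbar_lt t b.

Definition smooth_on (a b : Rbar) (f : R -> R) : Prop :=
  forall (n : nat) (t : R), in_interval a b t -> ex_derive_n f n t.

Definition smooth_curve (c d : Rbar) (P : R -> R * R) : Prop :=
  forall i : index, smooth_on c d (fun t => coord i (P t)).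

Definition velocity (P : R -> R * R) (s : R) : R * R :=
  (Derive (fun t => fst (P t)) s, Derive (fun t => snd (P t)) s).

Definition unit_speed (F : R * R -> R * R -> R) (c d : Rbar)
  (P : R -> R * R) : Prop :=
  forall s : R, in_interval c d s -> F (P s) (velocity P s) = 1.

(** Geodesic equation [x''^i + 2 G^i(x, x') = 0], for a curve in the
    coordinate domain [U]. *)
Definition geodesic (U : R * R -> Prop) (F : R * R -> R * R -> R)
  (c d : Rbar) (P : R -> R * R) : Prop :=
  smooth_curve c d P /\
  forall s : R, in_interval c d s ->
    U (P s) /\
    forall i : index,
      Derive_n (fun t => coord i (P t)) 2 s
      + 2 * spray F i (P s) (velocity P s) = 0.

(** * Surfaces of revolution

    The surface [(u, v) |-> (m u cos v, m u sin v, u)] with [u] in the open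
    interval [(a, b)].  The angle [v] on the circle is represented by a real
    number modulo [2 * PI]; no object below depends on the representative. *)

Definition surface_domain (a b : Rbar) (x : R * R) : Prop :=
  in_interval a b (fst x).

(** The norm of the metric induced from [R^3]. *)
Definition alpha (m : R -> R) (x y : R * R) : R :=
  sqrt ((1 + Derive m (fst x) ^ 2) * fst y ^ 2 + m (fst x) ^ 2 * snd y ^ 2).

Definition beta (x y : R * R) : R := fst y.

Definition slope_metric (m : R -> R) (x y : R * R) : R :=
  alpha m x y ^ 2 / (alpha m x y - beta x y).

Definition slope_strongly_convex (a b : Rbar) (m : R -> R) : Prop :=
  forall x y : R * R, surface_domain a b x -> y <> (0, 0) ->
    beta x y < alpha m x y /\ positive_definite_at (slope_metric m) x y.

(** A parametrized meridian; either direction of travel is allowed. *)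
Definition meridian (a b c d : Rbar) (P : R -> R * R) : Prop :=
  smooth_curve c d P /\
  (forall s : R, in_interval c d s -> surface_domain a b (P s)) /\
  exists v0 : R, forall s : R, in_interval c d s -> snd (P s) = v0.

(* Main.v *)
Require Import Defs.
From Stdlib Require Import Reals.
From Coquelicot Require Import Coquelicot.
From Stdlib Require Import Lra.
Open Scope R_scope.

(** The metric depends neither on the angle [v] nor on the sign of the angular
    velocity. So along a meridian, where the velocity is [(p, 0)], the
    derivatives of [F^2] in the angular directions vanish, the fundamental
    tensor is diagonal, and only the first spray coefficient can be nonzero:
    the meridian is the fixed curve of a reflection, and the geodesic equation
    reduces to one scalar equation for [u].

    On such vectors the metric is positively homogeneous: for a sign [e] with
    [0 < e * p], it equals [p * phi u] with
    [phi = (1 + m'^2) / (e sqrt (1 + m'^2) - 1)]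
    ([slope_metric_meridian]). Hence [g_11 = phi^2], the bracket in [G^1] is
    [2 p^2 phi phi'], and [2 G^1 = p^2 phi' / phi] ([spray_axis]). Unit speed
    says [u' phi(u) = 1]; differentiating gives
    [u'' phi + u'^2 phi' = 0], which is exactly [u'' + 2 G^1 = 0].

    The analytic care goes into the word even: an even function need not be
    differentiable at [0], so the vanishing of angular derivatives has to be
    backed by differentiability of [F], which holds because strong convexity
    makes [alpha - beta] positive. The most delicate case is the mixed
    coefficient [g_21], for which [F^2] is differentiated by hand once
    ([ex_derive_slope_mixed]). *)

(** * Even functions and neighbourhoods *)

(** Differentiability cannot be dropped: [Derive] is total, and for the absolute
    value it need not return [0]. *)
Lemma Derive_even (f : R -> R) :
  (forall t, f (- t) = f t) -> ex_derive f 0 -> Derive f 0 = 0.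
Proof.
  intros Hf Hd.
  assert (H : Derive f 0 = - Derive f 0).
  { rewrite <- (Derive_ext (fun t => f (- t)) f 0 Hf) at 1.
    rewrite Derive_comp, Derive_opp, Derive_id, Ropp_0.
    - ring.
    - rewrite Ropp_0; exact Hd.
    - auto_derive; exact I. }
  lra.
Qed.

Lemma Derive_square_even (f : R -> R) :
  (forall t, f (- t) = f t) -> ex_derive f 0 ->
  Derive (fun t => f t ^ 2) 0 = 0.
Proof.
  intros Hf Hd; apply Derive_even.
  - intros t; rewrite Hf; reflexivity.
  - auto_derive; exact Hd.
Qed.

Lemma locally_in_interval (a b : Rbar) (t : R) :
  in_interval a b t -> locally t (in_interval a b).
Proof.
  intros [Ha Hb].
  apply filter_and; [ apply (open_Rbar_gt a) | apply (open_Rbar_lt b) ];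
    assumption.
Qed.

(** Velocities of a meridian keep their direction of travel for a while, so the
    sign [e] of [u'] may be fixed once and for all near a given time. *)
Lemma locally_same_sign (e p : R) :
  0 < e * p -> locally p (fun t => 0 < e * t).
Proof.
  intros H.
  apply (continuous_comp (fun t : R => e * t) (fun t => t) p
          ltac:(apply (ex_derive_continuous (fun t : R => e * t)); auto_derive; exact I)
          (continuous_id _)
          (fun t => 0 < t)).
  apply (open_gt 0); exact H.
Qed.

(** * The spray of a reflection-symmetric metric along its axis *)

Section SymmetricAxis.

Variables (F : R * R -> R * R -> R) (phi : R -> R) (u v p : R).

Hypothesis F_even : forall x t w, F x (t, - w) = F x (t, w).
Hypothesis F_rot : forall r w w' y, F (r, w) y = F (r, w') y.
Hypothesis F_axis :
  locally p (fun t => forall r, F (r, v) (t, 0) = t * phi r).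
Hypothesis phi_derivable : ex_derive phi u.
Hypothesis F_transverse_x :
  locally u (fun r => ex_derive (fun w => F (r, v) (p, w)) 0).
Hypothesis F_transverse_y :
  locally p (fun t => ex_derive (fun w => F (u, v) (t, w)) 0).
Hypothesis F_transverse_d :
  ex_derive (fun w => Derive (fun t => F (u, v) (t, w) ^ 2) p) 0.
Hypothesis F_definite : positive_definite_at F (u, v) (p, 0).

Lemma Derive_square_axis (r : R) :
  locally p (fun t =>
    Derive (fun t' => F (r, v) (t', 0) ^ 2) t = 2 * t * phi r ^ 2).
Proof.
  generalize (locally_locally _ _ F_axis); apply filter_imp; intros t Ht.
  rewrite (Derive_ext_loc _ (fun t' => (t' * phi r) ^ 2)).
  - apply is_derive_unique; auto_derive; [ exact I | ring ].
  - generalize Ht; apply filter_imp; intros t' E; rewrite E; reflexivity.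
Qed.

Lemma fundamental_tensor_axis_11 :
  fundamental_tensor F i1 i1 (u, v) (p, 0) = phi u ^ 2.
Proof.
  unfold fundamental_tensor, partial; simpl coord; simpl set_coord.
  rewrite (Derive_ext_loc _ (fun t => 2 * t * phi u ^ 2)).
  - rewrite (is_derive_unique _ _ (2 * phi u ^ 2)); [ field | ].
    auto_derive; [ exact I | ring ].
  - exact (Derive_square_axis u).
Qed.

Lemma fundamental_tensor_axis_12 :
  fundamental_tensor F i1 i2 (u, v) (p, 0) = 0.
Proof.
  unfold fundamental_tensor, partial; simpl coord; simpl set_coord.
  rewrite (Derive_ext_loc _ (fun _ => 0)).
  - rewrite Derive_const; ring.
  - generalize F_transverse_y; apply filter_imp; intros t Ht.
    apply (Derive_square_even (fun w => F (u, v) (t, w))); auto.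
Qed.

(** The order of differentiation is the other one here than in [g_12], and no
    theorem on the symmetry of second derivatives is invoked: the inner
    derivative inherits evenness from [F]. *)
Lemma fundamental_tensor_axis_21 :
  fundamental_tensor F i2 i1 (u, v) (p, 0) = 0.
Proof.
  unfold fundamental_tensor, partial; simpl coord; simpl set_coord.
  rewrite Derive_even; [ ring | | exact F_transverse_d ].
  intros w; apply Derive_ext; intros t; simpl fst; rewrite F_even; reflexivity.
Qed.

(** Positive definiteness is used only through the two coordinate vectors,
    which give [0 < g_11 = phi^2] and [0 < g_22]; the determinant is then
    nonzero because the tensor is diagonal. *)
Lemma fundamental_tensor_axis_diag :
  phi u <> 0 /\ fundamental_tensor F i2 i2 (u, v) (p, 0) <> 0.
Proof.
  split.
  - intros H0.
    assert (H : 0 < phi u ^ 2).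
    { rewrite <- fundamental_tensor_axis_11.
      generalize (F_definite (1, 0) ltac:(intros E; injection E; lra)).
      unfold sum_index; simpl coord; lra. }
    rewrite H0 in H; lra.
  - generalize (F_definite (0, 1) ltac:(intros E; injection E; lra)).
    unfold sum_index; simpl coord; lra.
Qed.

(** With a diagonal tensor, [G^i] involves only the bracket with [l = i]. Both
    terms of the second bracket vanish, by evenness and by rotational
    invariance. In the first, [F^2 = t^2 phi^2] contributes
    [4 p^2 phi phi' - 2 p^2 phi phi']. *)
Lemma spray_axis (i : index) :
  spray F i (u, v) (p, 0) =
  match i with
  | i1 => p ^ 2 * Derive phi u / (2 * phi u)
  | i2 => 0
  end.
Proof.
  assert (Hxy1 : partial i1 (fun x' =>
            partial i1 (fun y' => F x' y' ^ 2) (p, 0)) (u, v)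
          = 4 * p * phi u * Derive phi u).
  { unfold partial; simpl coord; simpl set_coord.
    rewrite (Derive_ext _ (fun r => 2 * p * phi r ^ 2)).
    - apply is_derive_unique; auto_derive; 
        [ exact phi_derivable | change (fun x => phi x) with phi; ring ].
    - intros r; exact (locally_singleton _ _ (Derive_square_axis r)). }
  assert (Hx1 : partial i1 (fun x' => F x' (p, 0) ^ 2) (u, v)
          = 2 * p ^ 2 * phi u * Derive phi u).
  { unfold partial; simpl coord; simpl set_coord.
    rewrite (Derive_ext _ (fun r => (p * phi r) ^ 2)).
    - apply is_derive_unique; auto_derive; 
        [ exact phi_derivable | change (fun x => phi x) with phi; ring ].
    - intros r; simpl snd; rewrite (locally_singleton _ _ F_axis); reflexivity. }
  assert (Hxy2 : partial i1 (fun x' =>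
            partial i2 (fun y' => F x' y' ^ 2) (p, 0)) (u, v) = 0).
  { unfold partial; simpl coord; simpl set_coord.
    rewrite (Derive_ext_loc _ (fun _ => 0)); [ apply Derive_const | ].
    generalize F_transverse_x; apply filter_imp; intros r Hr.
    apply (Derive_square_even (fun w => F (r, v) (p, w))); auto. }
  assert (Hx2 : partial i2 (fun x' => F x' (p, 0) ^ 2) (u, v) = 0).
  { unfold partial; simpl coord; simpl set_coord.
    rewrite (Derive_ext _ (fun _ => F (u, v) (p, 0) ^ 2)).
    - apply Derive_const.
    - intros w; simpl fst; rewrite (F_rot u w v); reflexivity. }
  destruct fundamental_tensor_axis_diag as [Hphi H22].
  unfold spray, sum_index.
  rewrite Hxy1, Hx1, Hxy2, Hx2; simpl coord.
  destruct i; unfold inverse_tensor;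
    rewrite fundamental_tensor_axis_11, fundamental_tensor_axis_12,
      fundamental_tensor_axis_21; field; auto.
Qed.

End SymmetricAxis.

(** * The slope metric near a meridian *)

(** The [F]-length of the meridian vector [(e, 0)], up to the sign [e] of the
    direction of travel. Metrics of this kind are not reversible, so the two
    directions have different factors. *)
Definition meridian_factor (m : R -> R) (e u : R) : R :=
  (1 + Derive m u ^ 2) / (e * sqrt (1 + Derive m u ^ 2) - 1).

Lemma one_plus_sqr_pos (r : R) : 0 < 1 + r ^ 2.
Proof. generalize (pow2_ge_0 r); lra. Qed.

(** The identity extends to points where the denominator vanishes: both sides
    are then divisions by zero, and [/ (t * 0)] and [/ t * / 0] agree by the
    convention [/ 0 = 0]. So it holds for all [u], and derivatives in [u] need
    no choice of a neighbourhood. *)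
Lemma slope_metric_meridian (m : R -> R) (e u v t : R) :
  e ^ 2 = 1 -> 0 < e * t ->
  slope_metric m (u, v) (t, 0) = t * meridian_factor m e u.
Proof.
  intros He Ht.
  set (A := sqrt (1 + Derive m u ^ 2)).
  assert (HA : A ^ 2 = 1 + Derive m u ^ 2).
  { apply pow2_sqrt, Rlt_le, one_plus_sqr_pos. }
  assert (Ha : alpha m (u, v) (t, 0) = A * (e * t)).
  { unfold alpha; simpl fst; simpl snd.
    apply sqrt_lem_1.
    - rewrite <- HA; generalize (pow2_ge_0 (A * t)); lra.
    - apply Rmult_le_pos; [ apply sqrt_pos | lra ].
    - replace (A * (e * t) * (A * (e * t))) with (A ^ 2 * e ^ 2 * t ^ 2) by ring.
      rewrite HA, He; ring. }
  assert (Ht0 : t <> 0) by (intros E; rewrite E in Ht; lra).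
  unfold slope_metric, meridian_factor, beta; fold A.
  rewrite Ha, <- HA; simpl fst.
  replace (A * (e * t) - t) with (t * (e * A - 1)) by ring.
  unfold Rdiv; rewrite Rinv_mult.
  replace ((A * (e * t)) ^ 2) with (e ^ 2 * A ^ 2 * t ^ 2) by ring.
  rewrite He.
  generalize (/ (e * A - 1)); intros q.
  field; exact Ht0.
Qed.

Section Slope.

Variables (a b : Rbar) (m : R -> R).
Hypothesis m_smooth : smooth_on a b m.
Hypothesis F_convex : slope_strongly_convex a b m.

(** Convexity at the vector [(1, 0)] reads [1 < sqrt (1 + m'^2)]: a surface with
    [m' = 0] somewhere carries no strongly convex slope metric. *)
Lemma sqrt_slope_gt_1 (u : R) :
  in_interval a b u -> 1 < sqrt (1 + Derive m u ^ 2).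
Proof.
  intros Hu.
  destruct (F_convex (u, 0) (1, 0) Hu) as [H _].
  { intros E; injection E; lra. }
  unfold alpha, beta in H; simpl fst in H; simpl snd in H.
  replace ((1 + Derive m u ^ 2) * 1 ^ 2 + m u ^ 2 * 0 ^ 2)
    with (1 + Derive m u ^ 2) in H by ring.
  exact H.
Qed.

Lemma ex_derive_meridian_factor (e u : R) :
  e ^ 2 = 1 -> in_interval a b u -> ex_derive (meridian_factor m e) u.
Proof.
  intros He Hu.
  assert (Hm : ex_derive (Derive m) u) by exact (m_smooth 2%nat u Hu).
  generalize (sqrt_slope_gt_1 u Hu); intros HA.
  set (A := sqrt (1 + Derive m u ^ 2)) in HA.
  unfold meridian_factor.
  auto_derive; repeat split; try exact Hm.
  - generalize (one_plus_sqr_pos (Derive m u)); simpl; lra.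
  - replace (Derive m u * (Derive m u * 1)) with (Derive m u ^ 2) by ring.
    fold A.
    assert (Hc : e = 1 \/ e = -1).
    { assert (Hp : (e - 1) * (e + 1) = 0) by (ring_simplify; lra).
      destruct (Rmult_integral _ _ Hp); [ left | right ]; lra. }
    destruct Hc as [-> | ->]; lra.
Qed.

Lemma alpha_radicand_pos (x : R * R) (t w : R) :
  t <> 0 ->
  0 < (1 + Derive m (fst x) ^ 2) * t ^ 2 + m (fst x) ^ 2 * w ^ 2.
Proof.
  intros Ht.
  apply Rplus_lt_le_0_compat.
  - apply Rmult_lt_0_compat; [ apply one_plus_sqr_pos | ].
    generalize (pow2_gt_0 t Ht); lra.
  - apply Rmult_le_pos; apply pow2_ge_0.
Qed.

Lemma slope_denominator_neq_0 (x : R * R) (t w : R) :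
  surface_domain a b x -> t <> 0 ->
  sqrt ((1 + Derive m (fst x) ^ 2) * t ^ 2 + m (fst x) ^ 2 * w ^ 2) - t <> 0.
Proof.
  intros Hx Ht.
  destruct (F_convex x (t, w) Hx) as [H _].
  { intros E; injection E; intros; contradiction. }
  unfold alpha, beta in H; simpl in *; lra.
Qed.

Lemma ex_derive_slope_transverse (x : R * R) (t : R) :
  surface_domain a b x -> t <> 0 ->
  ex_derive (fun w => slope_metric m x (t, w)) 0.
Proof.
  intros Hx Ht.
  unfold slope_metric, alpha, beta; simpl fst; simpl snd.
  auto_derive.
  generalize (alpha_radicand_pos x t 0 Ht) (slope_denominator_neq_0 x t 0 Hx Ht).
  simpl; repeat split; auto.
Qed.

(** The inner derivative is a quotient whose only dependence on [w] is through
    the radicand [Q w] of [alpha]; since [Q] is positive and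
    [sqrt (Q w) - p] does not vanish, this quotient is differentiable. *)
Lemma ex_derive_slope_mixed (x : R * R) (p : R) :
  surface_domain a b x -> p <> 0 ->
  ex_derive (fun w => Derive (fun t => slope_metric m x (t, w) ^ 2) p) 0.
Proof.
  intros Hx Hp.
  set (K := 1 + Derive m (fst x) ^ 2).
  set (Q := fun w => K * p ^ 2 + m (fst x) ^ 2 * w ^ 2).
  apply (ex_derive_ext (fun w =>
    4 * K * p * Q w / (sqrt (Q w) - p) ^ 2
    - 2 * Q w ^ 2 * (K * p / sqrt (Q w) - 1) / (sqrt (Q w) - p) ^ 3)).
  (* The expression is the [t]-derivative at [p] of [alpha^4 / (alpha - t)^2]. *)
  - intros w; symmetry; apply is_derive_unique.
    generalize (alpha_radicand_pos x p w Hp) (slope_denominator_neq_0 x p w Hx Hp).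
    fold K; fold (Q w); intros HQ HD.
    assert (HS : sqrt (Q w) <> 0) by (generalize (sqrt_lt_R0 _ HQ); lra).
    apply (is_derive_ext_loc (fun t =>
      ((K * t ^ 2 + m (fst x) ^ 2 * w ^ 2)
         / (sqrt (K * t ^ 2 + m (fst x) ^ 2 * w ^ 2) - t)) ^ 2)).
    + apply filter_forall; intros t.
      unfold slope_metric, alpha, beta; simpl fst; simpl snd; fold K.
      rewrite pow2_sqrt; [ reflexivity | ].
      unfold K; generalize (one_plus_sqr_pos (Derive m (fst x)))
        (pow2_ge_0 t) (pow2_ge_0 (m (fst x) * w)); intros.
      apply Rplus_le_le_0_compat;
        apply Rmult_le_pos; try apply pow2_ge_0; lra.
    + unfold Q in *; auto_derive.
      * simpl in *; auto.
      * simpl in *; field; auto.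
  - generalize (alpha_radicand_pos x p 0 Hp) (slope_denominator_neq_0 x p 0 Hx Hp).
    fold K; unfold Q; intros HQ HD.
    assert (HS := sqrt_lt_R0 _ HQ).
    auto_derive; simpl in *; repeat split; auto; try lra.
    all: repeat apply Rmult_integral_contrapositive_currified; auto; lra.
Qed.

Lemma spray_slope_meridian (e u v p : R) (i : index) :
  in_interval a b u -> e ^ 2 = 1 -> 0 < e * p ->
  spray (slope_metric m) i (u, v) (p, 0) =
  match i with
  | i1 => p ^ 2 * Derive (meridian_factor m e) u / (2 * meridian_factor m e u)
  | i2 => 0
  end.
Proof.
  intros Hu He Hp.
  assert (nz : forall t, 0 < e * t -> t <> 0)
    by (intros t Ht E; rewrite E in Ht; lra).
  apply spray_axis.
  - intros x t w; unfold slope_metric, alpha; simpl fst; simpl snd.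
    replace ((- w) ^ 2) with (w ^ 2) by ring; reflexivity.
  - reflexivity.
  - generalize (locally_same_sign e p Hp); apply filter_imp.
    intros t Ht r; apply slope_metric_meridian; assumption.
  - apply ex_derive_meridian_factor; assumption.
  - generalize (locally_in_interval a b u Hu); apply filter_imp.
    intros r Hr; apply ex_derive_slope_transverse; auto.
  - generalize (locally_same_sign e p Hp); apply filter_imp.
    intros t Ht; apply ex_derive_slope_transverse; auto.
  - apply ex_derive_slope_mixed; auto.
  - apply F_convex; [ exact Hu | ].
    intros E; injection E; intros E'; exact (nz p Hp E').
Qed.

End Slope.

(** * Meridians are geodesics *)

Theorem proposition4p9
  (a b : Rbar) (hab : Rbar_lt a b)
  (m : R -> R)
  (m_pos : forall u : R, in_interval a b u -> 0 < m u)
  (m_smooth : smooth_on a b m)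
  (F_convex : slope_strongly_convex a b m)
  (c d : Rbar) (hcd : Rbar_lt c d)
  (P : R -> R * R)
  (P_meridian : meridian a b c d P)
  (P_unit : unit_speed (slope_metric m) c d P) :
  geodesic (surface_domain a b) (slope_metric m) c d P.
Proof.
  destruct P_meridian as [P_smooth [P_dom [v0 P_v]]].
  split; [ exact P_smooth | ].
  intros s Hs.
  split; [ exact (P_dom s Hs) | ].
  set (U := fun t => fst (P t)).
  assert (Pv : forall t, in_interval c d t -> P t = (U t, v0)).
  { intros t Ht; rewrite <- (P_v t Ht); apply surjective_pairing. }
  assert (dv : forall t, in_interval c d t -> Derive (fun t => snd (P t)) t = 0).
  { intros t Ht; rewrite (Derive_ext_loc _ (fun _ => v0)).
    - apply Derive_const.
    - generalize (locally_in_interval c d t Ht); apply filter_imp; exact P_v. }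
  assert (Pvel : forall t, in_interval c d t -> velocity P t = (Derive U t, 0)).
  { intros t Ht; unfold velocity; rewrite (dv t Ht); reflexivity. }
  assert (dU : ex_derive U s) by exact (P_smooth i1 1%nat s Hs).
  assert (ddU : ex_derive (Derive U) s) by exact (P_smooth i1 2%nat s Hs).
  assert (Hu : in_interval a b (U s)) by exact (P_dom s Hs).
  (* The zero vector has zero length, so unit speed rules it out. *)
  assert (Hp : Derive U s <> 0).
  { intros E.
    generalize (P_unit s Hs); rewrite (Pv s Hs), (Pvel s Hs), E.
    unfold slope_metric, alpha; simpl fst; simpl snd.
    replace ((1 + Derive m (U s) ^ 2) * 0 ^ 2 + m (U s) ^ 2 * 0 ^ 2)
      with 0 by ring.
    rewrite sqrt_0; unfold Rdiv; lra. }
  assert (He : exists e, e ^ 2 = 1 /\ 0 < e * Derive U s).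
  { destruct (Rdichotomy _ _ Hp); [ exists (-1) | exists 1 ]; split; lra. }
  destruct He as [e [He Hep]].
  assert (Hunit : locally s (fun t => Derive U t * meridian_factor m e (U t) = 1)).
  { assert (Hsign := ex_derive_continuous _ _ ddU _ (locally_same_sign _ _ Hep)).
    generalize (filter_and _ _ (locally_in_interval c d s Hs) Hsign).
    apply filter_imp; intros t [Ht Htp].
    rewrite <- (P_unit t Ht), (Pv t Ht), (Pvel t Ht).
    symmetry; apply slope_metric_meridian; assumption. }
  assert (dphi := ex_derive_meridian_factor a b m m_smooth F_convex e (U s) He Hu).
  (* Differentiating the unit-speed relation yields the geodesic equation. *)
  assert (Hode : Derive (Derive U) s * meridian_factor m e (U s)
            + Derive U s ^ 2 * Derive (meridian_factor m e) (U s) = 0).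
  { transitivity (Derive (fun t => Derive U t * meridian_factor m e (U t)) s).
    - rewrite Derive_mult, (Derive_comp (meridian_factor m e) U); auto.
      + ring.
      + apply ex_derive_comp; assumption.
    - rewrite <- (Derive_const 1 s).
      apply Derive_ext_loc; exact Hunit. }
  assert (Hphi : meridian_factor m e (U s) <> 0).
  { intros E; generalize (locally_singleton _ _ Hunit); rewrite E; lra. }
  intros i.
  rewrite (Pv s Hs), (Pvel s Hs).
  rewrite (spray_slope_meridian a b m m_smooth F_convex e); auto.
  destruct i.
  - change (Derive (Derive U) s
      + 2 * (Derive U s ^ 2 * Derive (meridian_factor m e) (U s)
             / (2 * meridian_factor m e (U s))) = 0).
    field_simplify_eq; [ lra | exact Hphi ].
  - change (Derive (Derive (fun t => snd (P t))) s + 2 * 0 = 0).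
    rewrite (Derive_ext_loc _ (fun _ => 0)).
    + rewrite Derive_const; ring.
    + generalize (locally_in_interval c d s Hs); apply filter_imp; exact dv.
Qed.
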